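(* Let $n\ge5$ and $K>0$. The potential difference $$\Delta U(q)=U(u^{(q+1/2)})-U(u^{(q+1)})$$ is a decreasing function of the integer $q$ for $0\le q\le\frac n4-1$.
   Context: $U(u)=-\frac{K}{2\pi}\sum_{i\in\mathbb{Z}/n\mathbb{Z}}\cos(2\pi(u_{i+1}-u_i))$. For an integer $k$, $u^{(k)}$ is the $k$-twisted state with components $u^{(k)}_i=\frac{ki}{n}$, $i=0,\dots,n-1$. For a half-integer $r$, $u^{(r)}$ has components $u^{(r)}_i=\frac{ri}{n-2}$, $i=0,\dots,n-1$. One has $U(u^{(k)})=-\frac{K}{2\pi}n\cos\bigl(\frac{2\pi k}{n}\bigr)$ and $U(u^{(r)})=-\frac{K}{2\pi}(n-2)\cos\bigl(\frac{2\pi r}{n-2}\bigr)$. *)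

(* Defs.v *)
From mathcomp Require Import all_boot all_order all_algebra.
From mathcomp Require Import reals trigo.
Set Implicit Arguments.
Unset Strict Implicit.
Unset Printing Implicit Defensive.
Import Order.TTheory GRing.Theory Num.Theory.
Local Open Scope ring_scope.

(* Z/nZ is 'I_n with the cyclic successor [ordS]; phases, which live in R/Z,
   are given by real representatives, the potential being invariant under
   integer shifts of each component. *)
Definition potential (R : realType) (n : nat) (K : R) (u : 'I_n -> R) : R :=
  - (K / (2 * pi)) * \sum_(i < n) cos (2 * pi * (u (ordS i) - u i)).

Definition twisted_state (R : realType) (n : nat) (k : int) : 'I_n -> R :=
  fun i => k%:~R * i%:R / n%:R.

(* Intended for half-integers r, i.e. r = q + 1/2 with q an integer. *)
Definition half_twisted_state (R : realType) (n : nat) (r : R) : 'I_n -> R :=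
  fun i => r * i%:R / (n%:R - 2).

Definition potential_difference (R : realType) (n : nat) (K : R) (q : int) : R :=
  potential K (@half_twisted_state R n (q%:~R + 1 / 2))
  - potential K (@twisted_state R n (q + 1)).

(* Main.v *)
(* A linear phase [u i = a * i] makes all edges of the cycle contribute
   [cos (2 pi a)], except the closing one.  This gives
   [Delta U q = K / (2 pi) * f q], where
   [f x = n cos (2 pi (x + 1) / n) - (n - 2) cos (2 pi (x + 1/2) / (n - 2))].
   The factors [n] and [n - 2] cancel in the derivative
   [2 pi (sin (2 pi (x + 1/2) / (n - 2)) - sin (2 pi (x + 1) / n))], and
   [(x + 1/2) / (n - 2) < (x + 1) / n <= 1/4] holds for
   [0 <= x < n/4 - 1], so [f' < 0] there because [sin] increases on [0, pi/2]. *)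
Require Import Defs.
From mathcomp Require Import all_boot all_order all_algebra.
From mathcomp Require Import ring lra.
From mathcomp Require Import classical_sets reals topology normedtype derive trigo.
Import Order.TTheory GRing.Theory Num.Theory.
Import numFieldNormedType.Exports.
Local Open Scope ring_scope.

Lemma cosD2piz (R : realType) (x : R) (k : int) :
  cos (x + 2 * pi * k%:~R) = cos x.
Proof.
have cosDn (y : R) (j : nat) : cos (y + 2 * pi * j%:R) = cos y.
  by rewrite mulr_natr mulr_natl (periodicn (@cosD2pi R)).
case: k => j; first exact: cosDn.
(* For negative [k], adding [j.+1] periods to the left-hand side cancels the shift. *)
by rewrite NegzE mulrNz -[LHS](cosDn _ j.+1); congr cos; rewrite -pmulrn; ring.
Qed.

Lemma potential_linear (R : realType) (m : nat) (K a : R)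
    (u : 'I_m.+1 -> R) :
  (forall i, u i = a * i%:R) ->
  potential K u
  = - (K / (2 * pi)) * (m%:R * cos (2 * pi * a) + cos (2 * pi * (a * m%:R))).
Proof.
move=> uE; rewrite /potential big_ord_recr /=; congr (_ * (_ + _)).
  rewrite (eq_bigr (fun=> cos (2 * pi * a))); last first.
    move=> i _; rewrite !uE /= modn_small ?ltnS ?ltn_ord// -[i.+1%:R]natr1.
    by congr cos; ring.
  by rewrite sumr_const card_ord -[LHS]mulr_natl.
(* The closing edge runs from [m] back to [0], so its difference is [- (a * m)]; cosine is even. *)
by rewrite !uE /= modnn mulr0 sub0r mulrN cosN.
Qed.

Lemma potential_twisted_state (R : realType) (n : nat) (K : R) (k : int) :
  (0 < n)%N ->
  potential K (@twisted_state R n k)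
  = - (K / (2 * pi)) * (n%:R * cos (2 * pi * k%:~R / n%:R)).
Proof.
case: n => // m _; rewrite (@potential_linear _ _ _ (k%:~R / m.+1%:R)); last first.
  by move=> i; rewrite /twisted_state mulrAC.
have n0 : m%:R + 1 != 0 :> R by rewrite natr1 pnatr_eq0.
(* With [n = m + 1], [k * m / n = k - k / n]: up to sign and a whole number of turns, the closing
   edge matches the others, giving [n] equal terms. *)
have -> : cos (2 * pi * (k%:~R / m.+1%:R * m%:R))
          = cos (2 * pi * (k%:~R / m.+1%:R)) :> R.
  rewrite -[RHS]cosN -[RHS](cosD2piz _ _ k).
  by congr cos; rewrite -[m.+1%:R]natr1; field.
by rewrite -[2 * pi * _ / _]mulrA -[m.+1%:R]natr1; ring.
Qed.

Lemma potential_half_twisted_state (R : realType) (n : nat) (K : R) (q : int) :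
  (2 < n)%N ->
  potential K (@half_twisted_state R n (q%:~R + 1 / 2))
  = - (K / (2 * pi))
    * ((n%:R - 2) * cos (2 * pi * (q%:~R + 1 / 2) / (n%:R - 2))).
Proof.
case: n => // m n3; set r := q%:~R + 1 / 2.
rewrite (@potential_linear _ _ _ (r / (m.+1%:R - 2))); last first.
  by move=> i; rewrite /half_twisted_state mulrAC.
have n0 : m%:R + 1 - 2 != 0 :> R.
  by rewrite natr1 subr_eq0 eqr_nat gtn_eqF.
(* Here [r * m / (m - 1) = r + r / (m - 1)], and [r] is [q] turns plus a half turn, which flips the
   sign. The closing edge thus cancels one of the [n - 1] others, leaving [n - 2]. *)
have -> : cos (2 * pi * (r / (m.+1%:R - 2) * m%:R))
          = - cos (2 * pi * (r / (m.+1%:R - 2))) :> R.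
  rewrite -[RHS](cosDpi) -[RHS](cosD2piz _ _ q).
  by congr cos; rewrite /r -[m.+1%:R]natr1; field.
by rewrite -[2 * pi * r / _]mulrA -[m.+1%:R]natr1; ring.
Qed.

Lemma is_derive_cos_affine (R : realType) (a b x : R) : a != 0 ->
  is_derive x 1 (fun y => a * cos (2 * pi * (y + b) / a))
    (- (2 * pi * sin (2 * pi * (x + b) / a))).
Proof.
move=> a0; apply: is_derive_eq.
by rewrite /GRing.scale /=; field.
Qed.

Lemma cos_difference_decreasing (R : realType) (a x y : R) :
  2 < a -> 0 <= x -> x < y -> y <= a / 4 - 1 ->
  a * cos (2 * pi * (y + 1) / a)
  - (a - 2) * cos (2 * pi * (y + 1 / 2) / (a - 2))
  < a * cos (2 * pi * (x + 1) / a)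
    - (a - 2) * cos (2 * pi * (x + 1 / 2) / (a - 2)).
Proof.
move=> a2 x0 xy ya.
have a_gt0 : 0 < a by lra.
have a2_gt0 : 0 < a - 2 by lra.
pose f z := a * cos (2 * pi * (z + 1) / a)
  - (a - 2) * cos (2 * pi * (z + 1 / 2) / (a - 2)).
pose df z := - (2 * pi * sin (2 * pi * (z + 1) / a))
  - - (2 * pi * sin (2 * pi * (z + 1 / 2) / (a - 2))).
have fD (z : R) : is_derive z 1 f (df z).
  by apply: is_deriveB; apply: is_derive_cos_affine; rewrite gt_eqF.
have fC : {within `[x, y], continuous f}%classic.
  apply: derivable_within_continuous => z _; exact: ex_derive.
have [c /[!in_itv]/= /andP[xc cy] fE] := MVT xy (fun z _ => fD z) fC.
rewrite -subr_lt0 -/(f y) -/(f x) fE pmulr_llt0 ?subr_gt0//.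
rewrite /df opprK addrC subr_lt0 ltr_pM2l ?mulr_gt0 ?pi_gt0//.
(* Cross-multiplied, this is [c < a / 4 - 1]; it is strict even if [y] is the endpoint, since the
   mean value point satisfies [c < y]. *)
have lt1 : (c + 1 / 2) / (a - 2) < (c + 1) / a.
  by rewrite ltr_pdivrMr// mulrAC ltr_pdivlMr//; lra.
have lt2 : (c + 1) / a <= 1 / 4 by rewrite ler_pdivrMr//; lra.
have lt0 : 0 <= (c + 1 / 2) / (a - 2) by rewrite divr_ge0//; lra.
have p0 := pi_gt0 R.
(* Both quotients lie in [[0, 1/4]], so both angles lie in [[0, pi/2]], where sine is increasing. *)
rewrite -!mulrA ltr_sin ?in_itv/=; [|apply/andP; split; nra..].
by rewrite !ltr_pM2l.
Qed.

Theorem proposition4p13 (R : realType) (n : nat) (K : R)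
    (hn : (5 <= n)%N) (hK : 0 < K) :
  forall q1 q2 : int,
    0 <= q1 -> q1 < q2 -> (q2%:~R : R) <= n%:R / 4 - 1 ->
    potential_difference n K q2 < potential_difference n K q1.
Proof.
move=> q1 q2 q1_ge0 q12 q2n.
have n2 : (2 < n)%N by apply: leq_trans hn.
have n0 : (0 < n)%N by apply: leq_trans hn.
rewrite /potential_difference !potential_half_twisted_state//.
rewrite !potential_twisted_state// -!mulrBr !mulNr ltrN2.
rewrite ltr_pM2l ?divr_gt0 ?mulr_gt0 ?pi_gt0// -ltrN2 !opprB !intrD.
by apply: cos_difference_decreasing; rewrite ?ler0z ?ltr_int ?ltr_nat.
Qed.
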